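(* Let $k\ge 3$, fix $0<c<1$, and let $d=d(n)=o(n)$. Then \[ \left\lvert\frac{\log \lvert\mathcal{G}_{d,c,k}(n)\rvert}{(d/2)n \log n} - \left(1 - c \cdot \frac{d-1}{d+1}\right)\right\rvert = O\left(\frac{\log d}{\log n}\right). \] Furthermore, if $d$ is fixed, then for every fixed $\varepsilon>0$, the proportion of elements of $\mathcal{G}_{d,c,k}(n)$ with more than $\varepsilon n$ bad nodes tends to $0$ as $n\to\infty$.
   Context: $\mathcal{G}_{d,c,k}(n)$ is the set of $d$-regular graphs on $n$ labeled nodes containing at least $c\binom{d}{k-1}\frac{n}{k}$ subgraphs isomorphic to the complete graph $K_k$ (note $\binom{d}{k-1}\frac nk$ is the maximum possible number). A node is bad if it is contained in some copy of $K_k$ but is not contained in any clique on $d+1$ nodes.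
   Formalization: Assumes d(n) ≥ k−1 for all n (for smaller d there are no copies of K_k and the formula fails, e.g. k=4, d=2), and both claims are made only for n with G_{d,c,k}(n) nonempty. *)

(* Defs.v *)
From HB Require Import structures.
From mathcomp Require Import all_boot all_order all_algebra.
From mathcomp Require Import reals exp.
Set Implicit Arguments. Unset Strict Implicit. Unset Printing Implicit Defensive.
Import Order.TTheory GRing.Theory Num.Theory.

(* A (candidate) graph on the labeled vertex set 'I_n: its set of edges. *)
Definition graph (n : nat) := {set {set 'I_n}}.

Definition simple_graph n (E : graph n) : bool := [forall e in E, #|e| == 2].

Definition deg n (E : graph n) (v : 'I_n) : nat := #|[set e in E | v \in e]|.

Definition regular n (d : nat) (E : graph n) : bool :=
  simple_graph E && [forall v, deg E v == d].

Definition is_clique n (E : graph n) (S : {set 'I_n}) : bool :=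
  [forall x in S, forall y in S, (x != y) ==> ([set x; y] \in E)].

(* vertex sets of the copies of K_k in E (one per subgraph isomorphic to K_k) *)
Definition kcliques n (k : nat) (E : graph n) : {set {set 'I_n}} :=
  [set S : {set 'I_n} | (#|S| == k) && is_clique E S].

Definition Gdck (R : realType) (n d : nat) (c : R) (k : nat) : {set graph n} :=
  [set E : graph n | regular d E &&
     (c * ('C(d, k.-1))%:R * (n%:R / k%:R) <= (#|kcliques k E|)%:R)%R].

Definition bad n (d k : nat) (E : graph n) (v : 'I_n) : bool :=
  [exists S in kcliques k E, v \in S] && ~~ [exists S in kcliques d.+1 E, v \in S].

Definition bad_nodes n (d k : nat) (E : graph n) : {set 'I_n} :=
  [set v | bad d k E v].

(* Main.v *)
(* Upper bound: order the vertices and call an edge xy cheap if some common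
   neighbour of x and y precedes both.  The non-cheap edges determine the graph
   up to d^O(nd) choices, so they carry all of the factor log n.  In a uniformly
   random order an edge lying in t triangles is cheap with probability
   t/(t+2) >= t/(d+1), hence some order has at least 3T/(d+1) cheap edges, T
   being the number of triangles; double counting triangles inside copies of K_k
   gives T >= c n d(d-1)/6.  A bad vertex lies on an edge with 0 < t < d-1, for
   which t/(t+2) exceeds t/(d+1) by at least 1/(d+1)^2, so linearly many bad
   vertices save a further linear number of non-cheap edges.

   Lower bound, when d^4 <= n: take m disjoint copies of K_(d+1), encoded by d
   permutations of m points, with (d+1)m close to cn and n - (d+1)m = 2dq; on
   the remaining vertices take a bipartite graph with d classes of size q on each
   side, joining any two opposite classes by an arbitrary perfect matching.  This
   gives (m!)^d (q!)^(d^2) distinct graphs.  When d^4 > n, log d / log n is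
   bounded below and only the upper bound has content. *)
Require Import Defs.
From HB Require Import structures.
From mathcomp Require Import all_boot all_order all_algebra all_fingroup.
From mathcomp Require Import reals exp.
From mathcomp Require Import zify ring lra.
Import Order.TTheory GRing.Theory Num.Theory.
Set Implicit Arguments. Unset Strict Implicit. Unset Printing Implicit Defensive.

(** * Encoding a graph by its non-cheap edges *)

Definition adj n (E : graph n) (x y : 'I_n) : bool := [set x; y] \in E.

Definition nbh n (E : graph n) (v : 'I_n) : {set 'I_n} := [set w | adj E v w].

Lemma in_nbh n (E : graph n) v w : (w \in nbh E v) = adj E v w.
Proof. by rewrite inE. Qed.

Lemma adj_sym n (E : graph n) x y : adj E x y = adj E y x.
Proof. by rewrite /adj setUC. Qed.

Lemma adj_neq n (E : graph n) x y : simple_graph E -> adj E x y -> x != y.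
Proof.
move=> /forall_inP sE /sE; rewrite cards2.
by case: (x != y).
Qed.

Lemma set2_injr n (v x y : 'I_n) : [set v; x] = [set v; y] -> x = y.
Proof.
move=> e; have := set22 v x; rewrite e !inE => /orP[/eqP xv|/eqP //].
have := set22 v y; rewrite -e !inE xv => /orP[/eqP ->|/eqP ->] //.
Qed.

Lemma deg_nbh n (E : graph n) v : simple_graph E -> deg E v = #|nbh E v|.
Proof.
move=> sE; rewrite /deg -(card_imset _ (@set2_injr n v)).
apply: eq_card => e; rewrite inE; apply/andP/imsetP => [[eE ve]|[w]].
  move/forall_inP: sE => /(_ _ eE)/cards2P [x [y [_ ee]]].
  move: ve eE; rewrite ee !inE => /orP[]/eqP -> h.
    by exists y => //; rewrite inE.
  by exists x; rewrite ?inE /adj setUC.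
by rewrite inE => h ->; rewrite set21.
Qed.

Lemma regular_card_nbh n d (E : graph n) v : regular d E -> #|nbh E v| = d.
Proof. by case/andP=> sE /forallP/(_ v)/eqP <-; rewrite deg_nbh. Qed.

Lemma regular_simple n d (E : graph n) : regular d E -> simple_graph E.
Proof. by case/andP. Qed.

Lemma eq_simple_graph n (E E' : graph n) :
  simple_graph E -> simple_graph E' -> adj E =2 adj E' -> E = E'.
Proof.
move=> sE sE' eqa; apply/setP => e; apply/idP/idP => eE.
  move/forall_inP: sE => /(_ _ eE)/cards2P [x [y [_ ee]]].
  by move: eE (eqa x y); rewrite ee /adj => -> <-.
move/forall_inP: sE' => /(_ _ eE)/cards2P [x [y [_ ee]]].
by move: eE (eqa x y); rewrite ee /adj => -> ->.
Qed.

(** Handshake count: summing degrees counts each edge twice. A nonempty family of d-regular graphs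
    thus supplies the parity that [split_size] requires. *)
Lemma regular_even n d (E : graph n) : regular d E -> ~~ odd (n * d).
Proof.
case/andP => /forall_inP sE /forallP rE.
have -> : n * d = \sum_(v < n) deg E v.
  rewrite (eq_bigr (fun=> d)) => [|v _]; last exact/eqP.
  by rewrite sum_nat_const card_ord.
have -> : \sum_(v < n) deg E v = \sum_(v < n) \sum_(e in E) (v \in e).
  apply: eq_bigr => v _; rewrite /deg -sum1_card big_mkcond [RHS]big_mkcond /=.
  by apply: eq_bigr => e _; rewrite inE; case: (e \in E); case: (v \in e).
rewrite exchange_big /= (eq_bigr (fun=> 2)) => [|e eE].
  by rewrite sum_nat_const oddM andbF.
rewrite -(eqP (sE e eE)) -sum1_card [RHS]big_mkcond /=.
by apply: eq_bigr => v _; case: (v \in e).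
Qed.

Definition cheap n (E : graph n) (s : 'S_n) (x y : 'I_n) : bool :=
  [exists z, [&& adj E x z, adj E y z, s z < s x & s z < s y]].

Lemma cheap_sym n (E : graph n) s x y : cheap E s x y = cheap E s y x.
Proof.
by apply: eq_existsb => z; rewrite andbCA; do 2!congr andb; rewrite andbC.
Qed.

Definition costly n (E : graph n) (s : 'S_n) : {set 'I_n * 'I_n} :=
  [set e : 'I_n * 'I_n | [&& e.1 < e.2, adj E e.1 e.2 & ~~ cheap E s e.1 e.2]].

(** Addressing a neighbour by its rank below d, instead of by its name, is what makes a cheap edge
    cost a power of d and not of n. *)
Definition port n (E : graph n) (v : 'I_n) (i : nat) : 'I_n :=
  nth v (enum (nbh E v)) i.

Section Encoding.
Variables (n d : nat).

Definition cell := ('I_n * 'I_d)%type.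
(** The first table names the far ends of the costly edges and is the only place where vertices are
    named. The second takes just 2 d^2 values per cell. *)
Definition code := ({ffun cell -> option 'I_n} * {ffun cell -> bool * 'I_d * 'I_d})%type.

(** Symmetrised, because a costly edge is recorded at its smaller endpoint only. *)
Definition stored (g : {ffun cell -> option 'I_n}) (v : 'I_n) : {set 'I_n} :=
  [set w | [exists i, (g (v, i) == Some w) || (g (w, i) == Some v)]].

(* A port is either looked up among the stored edges at [v], or reached from
   [v] by two steps through an earlier vertex [z]: both steps have an endpoint
   preceding [v] and the target, so decoding is well founded. *)
Definition cell_ok (E : graph n) (s : 'S_n) (g : {ffun cell -> option 'I_n})
    (vi : cell) (r : bool * 'I_d * 'I_d) : bool :=
  let: (b, a, a') := r in
  let w := port E vi.1 vi.2 in
  let z := port E vi.1 a in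
  if b then w == nth vi.1 (enum (stored g vi.1)) a
  else [&& w == port E z a', s z < s vi.1 & s z < s w].

Definition encodes (E : graph n) (c : code) : Prop :=
  exists s : 'S_n, forall vi : cell, cell_ok E s c.1 vi (c.2 vi).

Lemma port_adj (E : graph n) v (i : 'I_d) : regular d E -> adj E v (port E v i).
Proof.
move=> rE; rewrite -in_nbh -mem_enum; apply: mem_nth.
by rewrite -cardE (regular_card_nbh v rE).
Qed.

Lemma adj_port (E : graph n) v w : regular d E -> adj E v w -> exists i : 'I_d, w = port E v i.
Proof.
move=> rE; rewrite -in_nbh -mem_enum => wv.
have hi : index w (enum (nbh E v)) < d.
  by rewrite -[X in _ < X](regular_card_nbh v rE) cardE index_mem.
by exists (Ordinal hi); rewrite /port nth_index.
Qed.

Lemma port_inj (E : graph n) v : regular d E -> injective (fun i : 'I_d => port E v i).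
Proof.
move=> rE i j /eqP; rewrite nth_uniq ?enum_uniq -?cardE ?(regular_card_nbh v rE) //.
by move/eqP/val_inj.
Qed.

(** Ports of the two graphs are compared by induction on the smaller rank, in the order [s] of [E],
    of the two ends of the edge. A two-step port goes through a vertex [z] of smaller rank, so both
    steps fall under the induction hypothesis. The order of [E] alone drives the induction, hence no
    order has to be part of the code. *)
Lemma encodes_inj (E E' : graph n) c :
  regular d E -> regular d E' -> encodes E c -> encodes E' c -> E = E'.
Proof.
move=> rE rE' [s cE] [s' cE'].
have key r : forall v (i : 'I_d),
    minn (s v) (s (port E v i)) < r -> port E' v i = port E v i.
  elim: r => // r IH v i; rewrite ltnS => hr.
  move: (cE (v, i)) (cE' (v, i)); rewrite /cell_ok /=.
  case: (c.2 (v, i)) => [[[] a] b] /=; first by move=> /eqP -> /eqP ->.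
  move=> /and3P [/eqP e1 zv zw] /and3P [/eqP e2 _ _].
  have za : s (port E v a) < r.
    by apply: leq_trans hr; rewrite leq_min zv zw.
  have ea : port E' v a = port E v a.
    by apply: IH; apply: leq_ltn_trans za; rewrite geq_minr.
  rewrite e1 e2 ea; apply: IH; apply: leq_ltn_trans za.
  by rewrite geq_minl.
have pE v (i : 'I_d) : port E' v i = port E v i by exact: (key _ v i (leqnn _)).
apply: (eq_simple_graph (regular_simple rE) (regular_simple rE')) => x y.
apply/idP/idP => h.
  by have [i ->] := adj_port rE h; rewrite -pE port_adj.
by have [i ->] := adj_port rE' h; rewrite pE port_adj.
Qed.

Lemma encodes_exists (E : graph n) s : regular d E ->
  exists2 c : code, encodes E c
    & #|[set vi | c.1 vi != None]| <= #|costly E s|.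
Proof.
move=> rE; have sE := regular_simple rE.
pose g : {ffun cell -> option 'I_n} := [ffun vi : cell =>
  if (vi.1, port E vi.1 vi.2) \in costly E s then Some (port E vi.1 vi.2) else None].
(* Stored vertices are true neighbours, so at most d are stored at [v] and a position in that list
   fits in ['I_d]. *)
have subg v : stored g v \subset nbh E v.
  apply/subsetP => w; rewrite !inE => /existsP [i /orP[]]; rewrite ffunE /=;
    case: ifP => //; rewrite inE /= => /and3P [_ h _] /eqP [e].
    by rewrite -e.
  by rewrite adj_sym -e.
have hstored v w : adj E v w -> ~~ cheap E s v w -> w \in stored g v.
  move=> avw nc; rewrite inE.
  have := adj_neq sE avw; rewrite neq_ltn => /orP[lt|lt].
    have [i ew] := adj_port rE avw; apply/existsP; exists i.
    by rewrite ffunE /= -ew inE /= lt avw nc eqxx.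
  have avw' : adj E w v by rewrite adj_sym.
  have [i ew] := adj_port rE avw'; apply/existsP; exists i.
  by rewrite orbC ffunE /= -ew inE /= lt avw' cheap_sym nc eqxx.
have hh (vi : cell) : exists r, cell_ok E s g vi r.
  case: vi => v i; have avw := port_adj v i rE.
  have [|nc] := boolP (cheap E s v (port E v i)).
    case/existsP => z /and4P [az aw zv zw].
    have [a ea] := adj_port rE az.
    move: aw; rewrite adj_sym => aw; have [b eb] := adj_port rE aw.
    by exists (false, a, b); rewrite /cell_ok /= -ea -eb eqxx zv zw.
  have hin := hstored _ _ avw nc.
  have hi : index (port E v i) (enum (stored g v)) < d.
    apply: (@leq_trans #|stored g v|); first by rewrite cardE index_mem mem_enum.
    by rewrite -(regular_card_nbh v rE) subset_leq_card.
  by exists (true, Ordinal hi, i); rewrite /cell_ok /= nth_index ?mem_enum.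
have [h hP] := fin_all_exists hh.
exists (g, [ffun vi => h vi]).
  by exists s => vi; rewrite /= ffunE.
pose F (vi : cell) := (vi.1, port E vi.1 vi.2).
have Finj : injective F by move=> [v i] [v' i'] [<-] /(port_inj rE) ->.
rewrite -(card_imset _ Finj); apply: subset_leq_card.
apply/subsetP => _ /imsetP [vi + ->]; rewrite inE /= ffunE.
by case: ifP.
Qed.

(** Union bound over the support: there are at most 2^|T| supports, and one of size j <= f carries
    n^j functions. *)
Lemma card_bounded_support (T : finType) (f : nat) : 0 < n ->
  #|[set g : {ffun T -> option 'I_n} | #|[set x | g x != None]| <= f]|
    <= 2 ^ #|T| * n ^ f.
Proof.
move=> n0.
pose Q := [pred y : option 'I_n | y != None].
pose B := fun S : {set T} => [set g : {ffun T -> option 'I_n} | g \in pffun_on None (mem S) Q].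
have cB S : #|B S| = n ^ #|S|.
  rewrite /B cardsE card_pffun_on; congr (_ ^ _).
  transitivity #|predC1 (None : option 'I_n)|; first exact: eq_card.
  by rewrite cardC1 card_option card_ord.
apply: (@leq_trans #|\bigcup_(S : {set T} | #|S| <= f) B S|).
  apply: subset_leq_card; apply/subsetP => g; rewrite inE => hg.
  apply/bigcupP; exists [set x | g x != None] => //.
  rewrite inE; apply/pffun_onP; split.
    by apply/subsetP => x; rewrite !inE.
  by move=> y /imageP [x + ->]; rewrite !inE.
apply: leq_trans (_ : \sum_(S : {set T} | #|S| <= f) n ^ f <= _).
  elim/big_rec2: _ => [|S a b hS h]; first by rewrite cards0.
  apply: leq_trans (leq_card_setU _ _) _; rewrite leq_add // cB.
  by rewrite leq_pexp2l.
rewrite sum_nat_const leq_mul2r; apply/orP; right.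
apply: leq_trans (max_card _) _.
by rewrite -cardsT -powersetT card_powerset cardsT.
Qed.

(** An injection given as a relation; this form suits [encodes], which is a proposition with an
    existential order and not a map. *)
Lemma card_rel_le (S T : finType) (A : {set S}) (B : {set T}) (r : S -> T -> Prop) :
  (forall x, x \in A -> exists2 y, y \in B & r x y) ->
  (forall x x' y, x \in A -> x' \in A -> r x y -> r x' y -> x = x') ->
  #|A| <= #|B|.
Proof.
move=> ex inj; case: (pickP (mem B)) => [y0 _|B0]; last first.
  rewrite (_ : A = set0) ?cards0 //; apply/setP => x; rewrite inE.
  by apply/negP => /ex [y yB _]; move: (B0 y); rewrite /= yB.
have ex' x : exists y, x \in A -> y \in B /\ r x y.
  have [xA|xA] := boolP (x \in A); last by exists y0.
  by have [y yB h] := ex x xA; exists y.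
have [F FP] := fin_all_exists ex'.
rewrite -(card_in_imset (f := F) (D := mem A)).
  apply: subset_leq_card; apply/subsetP => _ /imsetP [x xA ->].
  by case: (FP x xA).
move=> x x' xA x'A e; have [_ h] := FP x xA; have [_ h'] := FP x' x'A.
by apply: inj h _ => //; rewrite e.
Qed.

Lemma card_few_costly (f : nat) (X : {set graph n}) : 0 < n ->
  (forall E, E \in X -> regular d E /\ exists s, #|costly E s| <= f) ->
  #|X| <= n ^ f * (4 * d ^ 2) ^ (n * d).
Proof.
move=> n0 hX.
pose B := [set c : code | #|[set x | c.1 x != None]| <= f].
apply: (@leq_trans #|B|).
  apply: (@card_rel_le _ _ X B encodes) => [E EX|E E' c EX E'X].
    have [rE [s hs]] := hX E EX; have [c cE hc] := encodes_exists s rE.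
    by exists c => //; rewrite inE (leq_trans hc hs).
  by apply: encodes_inj; [case: (hX E EX)|case: (hX E' E'X)].
have -> : B = setX [set g : {ffun cell -> option 'I_n} | #|[set x | g x != None]| <= f] setT.
  by apply/setP => -[g h]; rewrite !inE andbT.
rewrite cardsX; apply: leq_trans (leq_mul (card_bounded_support _ f n0) (leqnn _)) _.
rewrite cardsT card_ffun !card_prod !card_ord card_bool.
(* The factor 2^(nd) for the choice of support merges with (2 d^2)^(nd) for the second table. *)
rewrite [2 ^ _ * _]mulnC -mulnA -expnMn leq_mul2l; apply/orP; right.
by rewrite !mulnA.
Qed.

End Encoding.

(** * Random orders, triangles and bad vertices *)

Definition first n (s : 'S_n) (A : {set 'I_n}) (a : 'I_n) : bool :=
  (a \in A) && [forall b in A, s a <= s b].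

Lemma sum_first n (s : 'S_n) (A : {set 'I_n}) a0 : a0 \in A ->
  \sum_(a in A) first s A a = 1.
Proof.
move=> a0A; case: (arg_minnP (fun a => nat_of_ord (s a)) a0A) => m mA0 min; have mA : m \in A := mA0.
rewrite (bigD1 m) //= big1 => [|a /andP[aA am]].
  by rewrite /first mA; case: forall_inP.
rewrite /first aA /=; case: forall_inP => // /(_ m mA) le; case/eqP: am.
by apply: (@perm_inj _ s); apply: val_inj; apply/eqP; rewrite eqn_leq le min.
Qed.

(** By symmetry each element of [A] is equally often the earliest: composing with the transposition
    of [a] and [b] exchanges the orders where [a] is first with those where [b] is. *)
Lemma card_first n (A : {set 'I_n}) a : a \in A ->
  (\sum_(s : 'S_n) first s A a) * #|A| = n`!.
Proof.
move=> aA.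
have eqf b : b \in A -> \sum_(s : 'S_n) first s A b = \sum_(s : 'S_n) first s A a.
  move=> bA; rewrite (reindex_inj (mulgI (tperm a b))) /=; apply: eq_bigr => s _.
  rewrite /first aA bA /= permM tpermR; congr (nat_of_bool _).
  have tA x : (tperm a b x \in A) = (x \in A) by case: tpermP => [->|->|]; rewrite ?aA ?bA.
  apply/forall_inP/forall_inP => h x xA.
    by have := h (tperm a b x); rewrite tA permM tpermK; apply.
  by rewrite permM; apply: h; rewrite tA.
transitivity (\sum_(b in A) \sum_(s : 'S_n) first s A b).
  by rewrite (eq_bigr _ eqf) sum_nat_const mulnC.
rewrite exchange_big /= (eq_bigr (fun=> 1)) => [|s _]; last exact: sum_first aA.
by rewrite sum1_card -cardsT cardsT card_Sn.
Qed.

Definition codeg n (E : graph n) (x y : 'I_n) : nat := #|nbh E x :&: nbh E y|.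

(* The edge [xy] is cheap when the earliest vertex among [x], [y] and their
   common neighbours is one of the latter. *)
Lemma sum_cheap n (E : graph n) x y : simple_graph E -> adj E x y ->
  n`! * codeg E x y <= (\sum_(s : 'S_n) cheap E s x y) * (codeg E x y).+2.
Proof.
move=> sE axy; set C := nbh E x :&: nbh E y; pose A := x |: (y |: C).
have yC : y \notin C.
  by apply/negP; rewrite !inE => /andP[_ /(adj_neq sE)]; rewrite eqxx.
have xC : x \notin y |: C.
  rewrite in_setU1 negb_or (adj_neq sE axy) /=.
  by apply/negP; rewrite !inE => /andP[/(adj_neq sE)]; rewrite eqxx.
have cA : #|A| = (codeg E x y).+2 by rewrite !cardsU1 xC yC.
have CA z : z \in C -> z \in A by move=> zC; rewrite !in_setU1 zC !orbT.
have h : \sum_(z in C) \sum_(s : 'S_n) first s A z <= \sum_(s : 'S_n) cheap E s x y.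
  rewrite exchange_big /=; apply: leq_sum => s _.
  have [|nc] := boolP (cheap E s x y).
    move=> _; rewrite -[nat_of_bool true](@sum_first n s A x) ?in_setU1 ?eqxx //.
    rewrite [leqRHS]big_mkcond [leqLHS]big_mkcond /=; apply: leq_sum => z _.
    by case: ifP => // /CA ->.
  rewrite big1 // => z zC; apply/eqP; rewrite eqb0; apply: contra nc.
  case/andP=> _ /forall_inP hz; apply/existsP; exists z.
  have lt w : w \in A -> z != w -> s z < s w.
    move=> wA zw; rewrite ltn_neqAle hz // andbT; apply: contra zw => /eqP e.
    by apply/eqP; apply: (@perm_inj _ s); apply: val_inj.
  move: (zC); rewrite !inE => /andP[az bz]; rewrite az bz /= !lt //.
  - by rewrite !inE eqxx orbT.
  - by rewrite eq_sym (adj_neq sE bz).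
  - by rewrite !inE eqxx.
  - by rewrite eq_sym (adj_neq sE az).
rewrite -cA; apply: leq_trans (leq_mul h (leqnn _)).
rewrite big_distrl /= (eq_bigr (fun=> n`!)) => [|z zC]; last by apply: card_first; apply: CA.
by rewrite sum_nat_const mulnC.
Qed.

Lemma card_costly n (E : graph n) (s : 'S_n) : simple_graph E ->
  2 * #|costly E s| = \sum_x \sum_(y in nbh E x) ~~ cheap E s x y.
Proof.
move=> sE; pose r x y := adj E x y && ~~ cheap E s x y.
have rs x y : r x y = r y x by rewrite /r adj_sym cheap_sym.
have -> : #|costly E s| = \sum_(x : 'I_n) \sum_(y : 'I_n) ((x < y) && r x y).
  rewrite pair_big /= -sum1_card big_mkcond /=; apply: eq_bigr => -[x y] _.
  by rewrite inE /=; case: ifP.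
have -> : \sum_x \sum_(y in nbh E x) ~~ cheap E s x y = \sum_x \sum_y r x y.
  apply: eq_bigr => x _; rewrite big_mkcond /=; apply: eq_bigr => y _.
  by rewrite inE /r; case: adj.
rewrite mul2n -addnn {2}exchange_big /= -big_split /=; apply: eq_bigr => x _.
rewrite -big_split /=; apply: eq_bigr => y _; rewrite (rs y x).
have [h|] := boolP (r x y); last by rewrite !andbF.
have /(adj_neq sE) : adj E x y by case/andP: h.
by rewrite !andbT neq_ltn; case: ltngtP.
Qed.

(** * Triangles inside cliques, and edges at bad vertices *)

Lemma clique_adj n (E : graph n) S x y :
  is_clique E S -> x \in S -> y \in S -> x != y -> adj E x y.
Proof. by move=> /forall_inP h xS yS; move: (h x xS) => /forall_inP/(_ y yS)/implyP; apply. Qed.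

Definition triple_in n (S : {set 'I_n}) (x y z : 'I_n) : bool :=
  [&& x \in S, y \in S :\ x & z \in S :\ x :\ y].

Lemma count_triples n (S : {set 'I_n}) :
  \sum_x \sum_y \sum_z triple_in S x y z = #|S| * (#|S|.-1 * #|S|.-2).
Proof.
rewrite -sum_nat_const [RHS]big_mkcond /=; apply: eq_bigr => x _.
have [xS|xS] := ifPn; last first.
  by rewrite big1 // => y _; rewrite big1 // => z _; rewrite /triple_in (negbTE xS).
have c1 : #|S :\ x| = #|S|.-1 by rewrite (cardsD1 x S) xS.
rewrite -c1 -sum_nat_const [RHS]big_mkcond /=; apply: eq_bigr => y _.
have [yS|yS] := ifPn; last first.
  by rewrite big1 // => z _; rewrite /triple_in (negbTE yS) andbF.
have -> : #|S :\ x|.-1 = #|S :\ x :\ y| by rewrite (cardsD1 y (S :\ x)) yS.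
rewrite -sum1_card [RHS]big_mkcond /=; apply: eq_bigr => z _.
by rewrite /triple_in xS yS /=; case: ifP.
Qed.

(** Deleting [x], [y], [z] sends such cliques injectively to (k-3)-subsets of the d-2 remaining
    neighbours of [x]. *)
Lemma cliques_through_triangle n d k (E : graph n) x y z : regular d E ->
  2 < k -> y \in nbh E x -> z \in nbh E x :&: nbh E y ->
  \sum_(S in kcliques k E) triple_in S x y z <= 'C(d.-2, k - 3).
Proof.
move=> rE k3; have sE := regular_simple rE.
rewrite !inE => axy /andP[axz ayz].
have yz := adj_neq sE ayz.
have -> : \sum_(S in kcliques k E) triple_in S x y z =
    #|[set S in kcliques k E | triple_in S x y z]|.
  rewrite -sum1_card big_mkcond [RHS]big_mkcond /=; apply: eq_bigr => S _.
  by rewrite [in RHS]inE; case: (S \in _); case: triple_in.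
have cN : #|nbh E x :\ y :\ z| = d.-2.
  have := cardsD1 y (nbh E x); rewrite (regular_card_nbh x rE) in_nbh axy.
  have := cardsD1 z (nbh E x :\ y); rewrite !inE axz eq_sym yz /=.
  by move=> -> ->.
rewrite -cN -cards_draws.
rewrite -[leqLHS](card_in_imset (f := fun S : {set 'I_n} => S :\ x :\ y :\ z)).
  apply: subset_leq_card; apply/subsetP => _ /imsetP [S + ->].
  rewrite !inE => /andP[/andP[/eqP cS clS] /and3P [xS yS zS]].
  apply/andP; split.
    apply/subsetP => w; rewrite !inE => /and4P [-> -> wx wS] /=.
    by apply: (clique_adj clS) => //; rewrite eq_sym.
  have := cardsD1 x S; have := cardsD1 y (S :\ x); have := cardsD1 z (S :\ x :\ y).
  by rewrite xS yS zS cS => -> -> ->; rewrite !add1n !subSS subn0.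
move=> S S'; rewrite !inE => /andP[_ /and3P [xS yS zS]] /andP[_ /and3P [xS' yS' zS']] e.
rewrite -(setD1K xS) -(setD1K yS) -(setD1K zS) e.
by rewrite (setD1K zS') (setD1K yS') (setD1K xS').
Qed.

(** Double counting of pairs formed by a k-clique and an ordered triple of distinct vertices in it.
    The sum of [codeg] counts ordered triangles, that is, six times the number of triangles. *)
Lemma cliques_le_triangles n d k (E : graph n) : regular d E -> 2 < k ->
  #|kcliques k E| * (k * (k.-1 * k.-2))
    <= (\sum_x \sum_(y in nbh E x) codeg E x y) * 'C(d.-2, k - 3).
Proof.
move=> rE k3; have sE := regular_simple rE.
rewrite -sum_nat_const.
rewrite (eq_bigr (fun S => \sum_x \sum_y \sum_z triple_in S x y z)); last first.
  by move=> S; rewrite inE => /andP[/eqP {1 2 3}<- _]; rewrite count_triples.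
rewrite exchange_big big_distrl /=; apply: leq_sum => x _.
rewrite exchange_big big_distrl /= [leqRHS]big_mkcond /=; apply: leq_sum => y _.
rewrite exchange_big /=.
have none z : ~~ ((y \in nbh E x) && (z \in nbh E x :&: nbh E y)) ->
    \sum_(S in kcliques k E) triple_in S x y z = 0.
  move=> h; apply: big1 => S; rewrite inE => /andP[_ cS]; apply/eqP; rewrite eqb0.
  apply: contra h => /and3P [xS]; rewrite !inE => /andP[yx yS] /and3P [zy zx zS].
  by rewrite !(clique_adj cS) // eq_sym.
case: ifPn => [yx|yx]; last by rewrite big1 // => z _; apply: none; rewrite (negbTE yx).
rewrite /codeg -sum1_card big_distrl /= [leqRHS]big_mkcond /=; apply: leq_sum => z _.
case: ifPn => [zx|zx]; last by rewrite none // negb_and zx orbT.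
by rewrite mul1n (cliques_through_triangle rE).
Qed.

(** Suppose every edge at [v] lies in 0 or d-1 triangles. The copy of K_k gives an edge [vu] in a
    triangle, so [u] is adjacent to all other neighbours of [v]. Each such neighbour [w] then shares
    [u] with [v], so [vw] is also in d-1 triangles. Hence [v] and its neighbours form a clique on
    d+1 vertices, and [v] is not bad. *)
Lemma bad_edge n d k (E : graph n) v : regular d E -> 2 < k -> bad d k E v ->
  exists2 u, u \in nbh E v & 0 < codeg E v u < d.-1.
Proof.
move=> rE k3 /andP[/exists_inP [S]]; have sE := regular_simple rE.
rewrite inE => /andP[/eqP cS clS] vS nK.
(* The equality case is the point: d-1 triangles on [vu] means that [u] sees every other neighbour
   of [v]. *)
have tle u : adj E v u -> codeg E v u <= d.-1 ?= iff (nbh E v :\ u \subset nbh E u).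
  move=> avu; have vu := adj_neq sE avu.
  have -> : d.-1 = #|nbh E v :\ u|.
    by have := cardsD1 u (nbh E v); rewrite (regular_card_nbh v rE) in_nbh avu => ->.
  have -> : codeg E v u = #|(nbh E v :\ u) :&: nbh E u|.
    apply: eq_card => w; rewrite !inE; case: eqP => //= ->.
    by rewrite [adj E u u]/adj; apply/andP => -[_ /(adj_neq sE)]; rewrite eqxx.
  split; first by rewrite subset_leq_card // subsetIl.
  apply/idP/idP => [/eqP e|/setIidPl -> //].
  by apply/setIidPl/eqP; rewrite eqEcard subsetIl e /=.
have [/exists_inP [u uv h]|none] := boolP [exists u in nbh E v, 0 < codeg E v u < d.-1].
  by exists u.
case/negP: nK.
have dich u : adj E v u -> 0 < codeg E v u -> nbh E v :\ u \subset nbh E u.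
  move=> avu t0; rewrite -(tle u avu).2 eqn_leq (tle u avu).1 leqNgt.
  by apply: contra none => lt; apply/exists_inP; exists u; rewrite ?in_nbh // t0.
have : 0 < #|S :\ v| by have := cardsD1 v S; rewrite vS cS add1n => ek;
  move: k3; rewrite ek !ltnS; apply: ltnW.
case/card_gt0P => u; rewrite !inE => /andP[uv uS].
have : 0 < #|S :\ v :\ u|.
  have := cardsD1 v S; have := cardsD1 u (S :\ v); rewrite vS cS !inE uv uS !add1n => -> ek.
  by move: k3; rewrite ek !ltnS.
case/card_gt0P => w0; rewrite !inE => /and3P [w0u w0v w0S].
have avu : adj E v u by apply: (clique_adj clS); rewrite // eq_sym.
have su : nbh E v :\ u \subset nbh E u.
  apply: dich => //; apply/card_gt0P; exists w0.
  by rewrite !inE !(clique_adj clS) // eq_sym.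
have sw w : adj E v w -> nbh E v :\ w \subset nbh E w.
  move=> avw; have [->//|wu] := eqVneq w u.
  have : w \in nbh E v :\ u by rewrite !inE wu.
  move/(subsetP su); rewrite inE => auw.
  by apply: dich => //; apply/card_gt0P; exists u; rewrite !inE avu adj_sym.
apply/exists_inP; exists (v |: nbh E v); last by rewrite !inE eqxx.
have vN : v \notin nbh E v by rewrite in_nbh; apply/negP => /(adj_neq sE); rewrite eqxx.
rewrite inE cardsU1 vN (regular_card_nbh v rE) eqxx /=.
apply/forall_inP => a; rewrite !inE => ha; apply/forall_inP => b; rewrite !inE => hb.
apply/implyP => ab; rewrite -/(adj E a b).
case/orP: ha ab => [/eqP ->|ha]; case/orP: hb => [/eqP ->|hb]; rewrite ?eqxx // => ab.
  by rewrite adj_sym.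
by rewrite -in_nbh; apply: (subsetP (sw a ha)); rewrite !inE eq_sym ab.
Qed.

(** * Graphs made of cliques and bipartite blocks *)

Section GraphOf.
Variables (n : nat) (T : finType) (psi : T -> 'I_n).
Hypothesis psi_bij : bijective psi.
Variable r : rel T.
Hypothesis r_sym : symmetric r.
Hypothesis r_irr : irreflexive r.

Definition graph_of : graph n :=
  [set [set psi e.1; psi e.2] | e : T * T in [set e : T * T | r e.1 e.2]].

Lemma adj_graph_of x y : adj graph_of (psi x) (psi y) = r x y.
Proof.
have inj := bij_inj psi_bij.
apply/imsetP/idP => [[[a b]]|rxy]; last by exists (x, y); rewrite ?inE.
rewrite inE /= => rab e.
have [ex|ex] : psi x = psi a \/ psi x = psi b.
  by have := set21 (psi x) (psi y); rewrite e !inE => /orP[]/eqP; [left|right].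
- by move: e; rewrite ex => /set2_injr/inj ->; rewrite (inj _ _ ex).
- by move: e; rewrite ex (setUC [set psi a]) => /set2_injr/inj ->; rewrite (inj _ _ ex) r_sym.
Qed.

Lemma graph_of_regular d : (forall x, #|[set y | r x y]| = d) -> regular d graph_of.
Proof.
move=> rd; have inj := bij_inj psi_bij.
have sE : simple_graph graph_of.
  apply/forall_inP => _ /imsetP [[a b] + ->]; rewrite inE /= => rab.
  rewrite cards2 (inj_eq inj); have [ab|//] := eqVneq a b.
  by move: rab; rewrite ab r_irr.
apply/andP; split => //; apply/forallP => v; rewrite deg_nbh //.
case: psi_bij => psi' K K'; rewrite -(K' v) -[X in _ == X](rd (psi' v)).
rewrite -(card_imset _ inj); apply/eqP/eq_card => w.
rewrite in_nbh -(K' w) adj_graph_of (mem_imset _ _ inj).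
by rewrite inE.
Qed.

End GraphOf.

Section Frame.
Variables (d m q : nat).

(** Left: d+1 rows of m points, each clique taking one point from every row. Right: two sides, each
    of d classes of q points. *)
Definition frame := (('I_d.+1 * 'I_m) + (bool * 'I_d * 'I_q))%type.

Variables (f : {ffun 'I_d -> 'S_m}) (g : {ffun 'I_d * 'I_d -> 'S_q}).

(** Row 0 is labelled by the identity, which removes the freedom of renaming the cliques and lets
    [f] be recovered from the graph. *)
Definition clique_index (a : 'I_d.+1) : 'S_m :=
  if unlift ord0 a is Some a' then f a' else 1%g.

Definition frame_adj (u v : frame) : bool :=
  match u, v with
  | inl (a, i), inl (b, j) => (a != b) && (clique_index a i == clique_index b j)
  | inr (false, a, i), inr (true, b, j) => j == g (a, b) i
  | inr (true, b, j), inr (false, a, i) => j == g (a, b) i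
  | _, _ => false
  end.

Lemma frame_adj_sym : symmetric frame_adj.
Proof.
move=> [[a i]|[[[] a] i]] [[b j]|[[[] b] j]] //=.
by rewrite eq_sym; congr andb; rewrite eq_sym.
Qed.

Lemma frame_adj_irr : irreflexive frame_adj.
Proof. by move=> [[a i]|[[[] a] i]] //=; rewrite eqxx. Qed.

(** The map [F] lists the neighbours: one in each other row, or one in each class of the opposite
    side. *)
Lemma frame_deg u : #|[set v | frame_adj u v]| = d.
Proof.
case: u => [[a i]|[[[] b] j]].
- pose F b : frame := inl (b, (clique_index b)^-1%g (clique_index a i)).
  have Finj : injective F by move=> b b' [].
  transitivity #|F @: [set~ a]|; last by rewrite card_imset // cardsC1 card_ord.
  apply: eq_card => v; rewrite inE; apply/idP/imsetP => [|[b]].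
    case: v => [[b j]|//] /=; case/andP => ab /eqP e; exists b.
      by rewrite !inE eq_sym.
    by rewrite /F e permK.
  by rewrite !inE => ba ->; rewrite /F /= permKV eqxx eq_sym ba.
- pose F a : frame := inr (false, a, (g (a, b))^-1%g j).
  have Finj : injective F by move=> a a' [].
  transitivity #|F @: setT|; last by rewrite card_imset // cardsT card_ord.
  apply: eq_card => v; rewrite inE; apply/idP/imsetP => [|[a _ ->]].
    case: v => [[]//|[[[] a] i]] //= /eqP e; exists a => //.
    by rewrite /F e permK.
  by rewrite /F /= permKV.
- pose F a : frame := inr (true, a, g (b, a) j).
  have Finj : injective F by move=> a a' [].
  transitivity #|F @: setT|; last by rewrite card_imset // cardsT card_ord.
  apply: eq_card => v; rewrite inE; apply/idP/imsetP => [|[a _ ->]].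
    by case: v => [[]//|[[[] a] i]] //= /eqP e; exists a; rewrite // /F e.
  by rewrite /F /=.
Qed.

Definition clique_vertex (l : 'I_m) (a : 'I_d.+1) : frame :=
  inl (a, (clique_index a)^-1%g l).

Lemma clique_vertex_inj l l' a a' :
  clique_vertex l a = clique_vertex l' a' -> l = l' /\ a = a'.
Proof. by case=> -> /perm_inj. Qed.

Lemma clique_vertex_adj l a b : a != b -> frame_adj (clique_vertex l a) (clique_vertex l b).
Proof. by rewrite /= !permKV eqxx andbT. Qed.

End Frame.

(** The value [f a i] is read off as the row 0 neighbour of point [i] in row [lift ord0 a], and
    [g (a, b) i] as the neighbour of [i] in the opposite class [b]. *)
Lemma frame_adj_inj d m q (f f' : {ffun 'I_d -> 'S_m}) (g g' : {ffun 'I_d * 'I_d -> 'S_q}) :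
  frame_adj f g =2 frame_adj f' g' -> f = f' /\ g = g'.
Proof.
move=> e; split.
  apply/ffunP => a; apply/permP => i.
  have : frame_adj f' g' (inl (ord0, f a i)) (inl (lift ord0 a, i)).
    by rewrite -e /= /clique_index unlift_none liftK perm1 eqxx.
  by rewrite /= /clique_index unlift_none liftK perm1 => /eqP.
apply/ffunP => -[a b]; apply/permP => i.
by have := e (inr (false, a, i)) (inr (true, b, g (a, b) i)); rewrite /= eqxx => /esym/eqP.
Qed.

Lemma many_regular_graphs n d m q k : 0 < k -> n = d.+1 * m + 2 * d * q ->
  exists2 X : {set graph n}, #|X| = m`! ^ d * q`! ^ (d * d)
    & forall E, E \in X -> regular d E /\ m * 'C(d.+1, k) <= #|kcliques k E|.
Proof.
move=> k0 en.
have cT : #|{: ('I_d.+1 * 'I_m) + (bool * 'I_d * 'I_q)}| = n.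
  by rewrite card_sum !card_prod card_bool !card_ord en.
pose psi (t : frame d m q) : 'I_n := cast_ord cT (enum_rank t).
have psi_bij : bijective psi.
  exists (fun i => enum_val (cast_ord (esym cT) i)) => t; rewrite /psi.
    by rewrite cast_ordK enum_rankK.
  by rewrite enum_valK cast_ordKV.
have inj := bij_inj psi_bij.
pose D := ({ffun 'I_d -> 'S_m} * {ffun 'I_d * 'I_d -> 'S_q})%type.
pose G (x : D) := graph_of psi (frame_adj x.1 x.2).
have adjG x u v : adj (G x) (psi u) (psi v) = frame_adj x.1 x.2 u v.
  exact: (adj_graph_of psi_bij (@frame_adj_sym _ _ _ _ _)).
have Ginj : injective G.
  move=> [f g] [f' g'] e; have [|-> ->] // := @frame_adj_inj d m q f f' g g'.
  by move=> u v; rewrite -(adjG (f, g)) e adjG.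
exists [set G x | x : D].
  rewrite card_imset // card_prod !card_ffun card_prod !card_ord.
  by rewrite -!card_Sn.
move=> _ /imsetP [x _ ->]; split.
  apply: graph_of_regular => //; [exact: frame_adj_sym|exact: frame_adj_irr|].
  exact: frame_deg.
pose w l a := psi (clique_vertex q x.1 l a).
have winj l l' a a' : w l a = w l' a' -> l = l' /\ a = a'.
  by move/inj/clique_vertex_inj.
pose P := setX [set: 'I_m] [set B : {set 'I_d.+1} | B \subset setT & #|B| == k].
pose K (p : 'I_m * {set 'I_d.+1}) := [set w p.1 a | a in p.2].
have -> : m * 'C(d.+1, k) = #|P|.
  by rewrite cardsX cardsT card_ord cards_draws cardsT card_ord.
rewrite -[leqLHS](card_in_imset (f := K)); last first.
  move=> [l B] [l' B']; rewrite !inE /= !subsetT /= => /eqP cB /eqP cB' e.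
  have sub l1 B1 l2 B2 : K (l1, B1) = K (l2, B2) -> forall a, a \in B1 -> l1 = l2 /\ a \in B2.
    move=> e12 a aB; have : w l1 a \in K (l1, B1) by apply: imset_f.
    by rewrite e12 => /imsetP [b bB /winj [-> ->]].
  (* Here k > 0 matters: only a nonempty vertex set determines the clique it is taken from. *)
  have : 0 < #|B| by rewrite cB.
  case/card_gt0P => a0 /(sub _ _ _ _ e) [ll _]; congr pair => //.
  apply/setP => a; apply/idP/idP; first by case/(sub _ _ _ _ e).
  by case/(sub _ _ _ _ (esym e)).
apply: subset_leq_card; apply/subsetP => _ /imsetP [[l B] + ->].
rewrite !inE /= subsetT /= => /eqP cB; apply/andP; split.
  by rewrite /K /= card_imset ?cB // => a a' /winj [].
apply/forall_inP => _ /imsetP [a aB ->]; apply/forall_inP => _ /imsetP [b bB ->].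
apply/implyP => ab; rewrite -/(adj (G x) (w l a) (w l b)) adjG clique_vertex_adj //.
by apply: contra ab => /eqP ->.
Qed.

(* As [nd] is even, [(d+1)^2 n = n] modulo [2d], so [m = (d+1) n] modulo [2d]
   makes [n - (d+1)m] a multiple of [2d]. *)
Lemma split_size n d m0 : 0 < d -> ~~ odd (n * d) -> d.+1 * (m0 + 2 * d) <= n ->
  exists m q, [/\ m0 <= m, m < m0 + 2 * d & n = d.+1 * m + 2 * d * q].
Proof.
move=> d0 ev le; have dd0 : 0 < 2 * d by lia.
pose m := m0 + (d.+1 * n + (2 * d - m0 %% (2 * d))) %% (2 * d).
have lt : m < m0 + 2 * d by rewrite /m ltn_add2l ltn_mod.
have le' : d.+1 * m <= n by apply: leq_trans le; rewrite leq_mul2l (ltnW lt).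
have em : m = d.+1 * n %[mod 2 * d].
  rewrite /m modnDmr addnC -modnDmr -addnA subnK ?modnDr //.
  by rewrite ltnW // ltn_mod.
have en : d.+1 * m = n %[mod 2 * d].
  rewrite -modnMmr em modnMmr.
  have -> : d.+1 * (d.+1 * n) = (n * d)./2 * (2 * d) + n * (2 * d) + n.
    have := odd_double_half (n * d); rewrite (negbTE ev) add0n -mul2n; nia.
  by rewrite -mulnDl modnMDl.
have : 2 * d %| n - d.+1 * m by rewrite -eqn_mod_dvd // eq_sym; apply/eqP.
case/dvdnP => q eq; exists m, q; split => //; first by rewrite /m leq_addr.
by rewrite [2 * d * q]mulnC -eq subnKC.
Qed.

(** * Estimates *)

Local Open Scope ring_scope.

Lemma exists_ge_mean (R : realDomainType) (T : finType) (F : T -> R) (a : R) :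
  (0 < #|T|)%N -> #|T|%:R * a <= \sum_x F x -> exists x, a <= F x.
Proof.
move=> /card_gt0P [x0 _] h; apply/existsP; apply: contraLR h => /existsPn h.
rewrite -ltNge mulr_natl -[#|T|]sum1_card -sumrMnr.
by apply: ltr_sum; [apply/hasP; exists x0; rewrite ?mem_index_enum|move=> x _; rewrite ltNge h].
Qed.

(** First moment: by [sum_cheap] the mean number of cheap ordered pairs is at least the sum of
    t/(t+2), and some order reaches the mean. Ordered pairs account for the factor 2. *)
Lemma exists_few_costly (R : realFieldType) n d (E : graph n) : regular d E ->
  exists s : 'S_n, 2 * (#|costly E s|)%:R <=
    n%:R * d%:R - \sum_x \sum_(y in nbh E x) (codeg E x y)%:R / ((codeg E x y)%:R + 2) :> R.
Proof.
move=> rE; have sE := regular_simple rE.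
set S := \sum_x _.
pose F (s : 'S_n) : R := \sum_x \sum_(y in nbh E x) (cheap E s x y)%:R.
have [s hs] : exists s, S <= F s.
  apply: exists_ge_mean; first by rewrite -cardsT cardsT card_Sn fact_gt0.
  rewrite /F exchange_big /= mulr_sumr ler_sum // => x _.
  rewrite exchange_big /= mulr_sumr ler_sum // => y; rewrite inE => axy.
  have t0 : 0 < (codeg E x y)%:R + 2 :> R by rewrite -natrD ltr0n addn2.
  rewrite mulrA ler_pdivrMr // -natr_sum -natrD addn2 -!natrM ler_nat.
  by rewrite -[#|_|]cardsT cardsT card_Sn sum_cheap.
exists s; rewrite -natrM card_costly // natr_sum.
have -> : n%:R * d%:R = \sum_x \sum_(y in nbh E x) 1 :> R.
  rewrite (eq_bigr (fun=> d%:R)) => [|x _]; first by rewrite sumr_const card_ord mulr_natl.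
  by rewrite sumr_const (regular_card_nbh x rE).
suff -> : \sum_x (\sum_(y in nbh E x) ~~ cheap E s x y)%:R = \sum_x \sum_(y in nbh E x) 1 - F s :> R.
  by rewrite lerB.
rewrite -sumrB; apply: eq_bigr => x _; rewrite natr_sum -sumrB; apply: eq_bigr => y _.
by case: cheap; rewrite ?subrr ?subr0.
Qed.

(** Since t <= d-1, each term t/(t+2) is at least t/(d+1). For a bad [x] the edge of [bad_edge]
    gains 1/(d+1)^2 more; the sum is over ordered pairs, so an edge shared by two bad vertices is
    credited once to each. *)
Lemma codeg_sum_gain (R : realFieldType) n d k (E : graph n) : regular d E -> (2 < k)%N ->
  (\sum_x \sum_(y in nbh E x) codeg E x y)%:R / (d%:R + 1)
    + (#|bad_nodes d k E|)%:R / (d%:R + 1) ^+ 2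
  <= \sum_x \sum_(y in nbh E x) (codeg E x y)%:R / ((codeg E x y)%:R + 2) :> R.
Proof.
move=> rE k3; have sE := regular_simple rE.
have d0 : 0 < d%:R + 1 :> R by rewrite natr1 ltr0n.
have t0 x y : 0 < (codeg E x y)%:R + 2 :> R by rewrite -natrD ltr0n addn2.
have tle x y : adj E x y -> (codeg E x y <= d.-1)%N.
  move=> axy; have := cardsD1 y (nbh E x); rewrite (regular_card_nbh x rE) in_nbh axy.
  move=> ->; apply: subset_leq_card; apply/subsetP => w; rewrite !inE => /andP[-> ayw].
  by rewrite eq_sym (adj_neq sE ayw).
have term x y : adj E x y ->
    (codeg E x y)%:R / (d%:R + 1) <= (codeg E x y)%:R / ((codeg E x y)%:R + 2) :> R.
  move=> axy; rewrite ler_wpM2l // lef_pV2 ?posrE // natr1 -natrD ler_nat.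
  have := tle x y axy.
  have : (0 < d)%N by rewrite -(regular_card_nbh x rE); apply/card_gt0P; exists y; rewrite inE.
  lia.
have termb x y : (0 < codeg E x y < d.-1)%N ->
    (codeg E x y)%:R / (d%:R + 1) + 1 / (d%:R + 1) ^+ 2
      <= (codeg E x y)%:R / ((codeg E x y)%:R + 2) :> R.
  move=> /andP[t1 t2].
  (* Writing d = t + s + 2 turns the claim into positivity of a polynomial in t >= 1 and s >= 0. *)
  have [s es] : exists s, d = (codeg E x y + s + 2)%N by exists (d - 2 - codeg E x y)%N; lia.
  move: (t0 x y) d0 t1; set t := codeg E x y in es *; rewrite es !natrD => T0 D0 t1.
  have T1 : 1 <= t%:R :> R by rewrite ler1n.
  have S0 : 0 <= s%:R :> R by rewrite ler0n.
  move: (t%:R : R) (s%:R : R) T0 D0 T1 S0 => u v T0 D0 T1 S0.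
  rewrite -subr_ge0.
  have -> : u / (u + 2) - (u / (u + v + 2 + 1) + 1 / (u + v + 2 + 1) ^+ 2) =
    (u * (v + 1) * (u + v + 3) - (u + 2)) / ((u + 2) * (u + v + 2 + 1) ^+ 2).
    by field; rewrite ?lt0r_neq0 //; lra.
  apply: divr_ge0; last by rewrite mulr_ge0 ?exprn_ge0 ?ltW.
  nra.
have -> : (#|bad_nodes d k E|)%:R = \sum_x (bad d k E x)%:R :> R.
  rewrite -natr_sum -sum1_card big_mkcond /=; congr (_%:R); apply: eq_bigr => x _.
  by rewrite inE; case: bad.
rewrite natr_sum !mulr_suml -big_split /=; apply: ler_sum => x _.
rewrite natr_sum mulr_suml.
have [bx|_] := boolP (bad d k E x); last first.
  by rewrite mul0r addr0; apply: ler_sum => y; rewrite inE => /term.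
have [u ux tu] := bad_edge rE k3 bx.
rewrite (bigD1 u) //= [leRHS](bigD1 u) //= addrAC lerD ?termb //.
by apply: ler_sum => y /andP[]; rewrite inE => /term.
Qed.

Lemma many_triangles (R : realFieldType) n d k (c : R) (E : graph n) :
  (2 < k)%N -> (k.-1 <= d)%N -> regular d E ->
  c * ('C(d, k.-1))%:R * (n%:R / k%:R) <= (#|kcliques k E|)%:R ->
  c * n%:R * d%:R * (d%:R - 1) <= (\sum_x \sum_(y in nbh E x) codeg E x y)%:R.
Proof.
move=> k3 kd rE h; set T := (\sum_x _)%N.
have B0 : (0 < 'C(d.-2, k - 3))%N by rewrite bin_gt0; lia.
have B0R : 0 < ('C(d.-2, k - 3))%:R :> R by rewrite ltr0n.
have := cliques_le_triangles rE k3; rewrite -/T -(ler_nat R) => h2.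
(* Two absorptions; the binomial then cancels, being positive because k-1 <= d. *)
have e : ('C(d, k.-1) * (k.-1 * k.-2) = d * d.-1 * 'C(d.-2, k - 3))%N.
  have [j ->] : exists j, k = j.+3 by exists (k - 3)%N; lia.
  have [d2 ->] : exists d2, d = d2.+2 by exists d.-2; lia.
  rewrite /= -[j.+3]addn3 addnK.
  have := mul_bin_diag d2.+2 j.+1; have := mul_bin_diag d2.+1 j => /= h3 h4.
  rewrite mulnA [('C(_, _) * _)%N]mulnC -h4 -mulnA [('C(_, _) * _)%N]mulnC -h3.
  by rewrite mulnA.
rewrite -(ler_pM2r B0R) -natrM; apply: le_trans h2.
rewrite natrM; apply: le_trans (ler_wpM2r _ h) => //.
have k0 : k%:R != 0 :> R by rewrite pnatr_eq0; lia.
rewrite natrM; move/(congr1 (fun i : nat => i%:R : R)): e; rewrite !natrM => e.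
have -> : c * ('C(d, k.-1))%:R * (n%:R / k%:R) * (k%:R * (k.-1%:R * k.-2%:R))
  = c * n%:R * (('C(d, k.-1))%:R * (k.-1%:R * k.-2%:R)) by field.
have -> : d%:R - 1 = d.-1%:R :> R by rewrite -subn1 natrB //; lia.
by rewrite e !mulrA.
Qed.

(** Weak Stirling bound j! >= (j/e)^j. The induction step amounts to j (ln (j+1) - ln j) <= 1. *)
Lemma ln_fact_ge (R : realType) (j : nat) : j%:R * (ln j%:R - 1) <= ln (j`!)%:R :> R.
Proof.
elim: j => [|j IH]; first by rewrite mul0r fact0 ln1.
rewrite factS natrM lnM ?posrE ?ltr0n ?fact_gt0 //.
case: j IH => [|j] IH; first by rewrite fact0 ln1; lra.
have j0 : 0 < j.+1%:R :> R by rewrite ltr0n.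
have h : ln (j.+2%:R) - ln (j.+1%:R) <= (j.+1%:R)^-1 :> R.
  rewrite -ln_div ?posrE ?ltr0n //.
  have -> : j.+2%:R / j.+1%:R = 1 + (j.+1%:R)^-1 :> R.
    by rewrite -(natr1 j.+1) mulrDl mulfV ?mul1r // gt_eqF.
  by apply: le_ln1Dx; apply: lt_trans (_ : 0 < _); rewrite ?invr_gt0 //; lra.
have h2 : j.+1%:R * (ln (j.+2%:R) - ln (j.+1%:R)) <= 1 :> R.
  by rewrite -[leRHS](@mulfV _ (j.+1%:R : R)) ?gt_eqF // ler_wpM2l // ltW.
have e : j.+2%:R = j.+1%:R + 1 :> R by rewrite natr1.
move: IH h2; move: (ln j.+2%:R) (ln (j.+1)`!%:R) (ln j.+1%:R) => a b l.
rewrite e; move: (j.+1%:R : R) => t; nra.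
Qed.

Lemma ln_natXX (R : realType) (a b i j : nat) : (0 < a)%N -> (0 < b)%N ->
  ln ((a ^ i * b ^ j)%N%:R) = i%:R * ln a%:R + j%:R * ln b%:R :> R.
Proof.
move=> a0 b0; rewrite natrM (natrX _ a) (natrX _ b).
by rewrite lnM ?posrE ?exprn_gt0 ?ltr0n // !lnXn ?ltr0n // !mulr_natl.
Qed.

Lemma ln_mul_div (R : realType) (a b e : R) : 0 < a -> 0 < b -> 0 < e ->
  ln (a * b / e) = ln a + ln b - ln e.
Proof. by move=> a0 b0 e0; rewrite ln_div ?posrE ?mulr_gt0 // lnM. Qed.

(** Read [x] as cn/(d+1) and [L], [l], [lm], [lq] as the logarithms of n, d, m, q. The weight [W] =
    dm + d^2 q counts the factors ln n in the logarithm of (m!)^d (q!)^(d^2). Rounding [x] up to [m]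
    costs at most d^3 L <= 2nd, and replacing [lm] - 1 and [lq] - 1 by [L] costs at most nd(2l +
    K). *)
Lemma lower_bound_arith (R : realFieldType) (n d m q x lm lq L l K C : R) :
  2 <= d -> 0 <= m -> 0 <= q -> 0 <= L -> 0 <= l -> 0 <= K ->
  n = (d + 1) * m + 2 * d * q -> m <= x + 2 * d -> d ^+ 2 * L <= 2 * n ->
  2 + K <= C * l -> L - 2 * l - K <= lm - 1 -> L - 2 * l - K <= lq - 1 ->
  (n * d - x * d * (d - 1)) / 2 * L - (2 + C) * (n * d * l)
    <= d * (m * (lm - 1)) + d ^+ 2 * (q * (lq - 1)).
Proof.
move=> d2 m0 q0 L0 l0 K0 en mu dL CK hm hq.
have d0 : 0 <= d by lra.
have n0 : 0 <= n by rewrite en addr_ge0 // !mulr_ge0 //; lra.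
set W : R := d * m + d ^+ 2 * q.
have eW : W = (n * d - m * (d * (d - 1))) / 2 by rewrite /W en; field.
have Wu : W <= n * d.
  rewrite eW; have : 0 <= m * (d * (d - 1)) by rewrite !mulr_ge0 //; lra.
  have : 0 <= n * d by rewrite mulr_ge0.
  lra.
have Wl : (n * d - x * d * (d - 1)) / 2 - d * d ^+ 2 <= W.
  rewrite eW.
  have : m * (d * (d - 1)) <= (x + 2 * d) * (d * (d - 1)).
    by rewrite ler_wpM2r // mulr_ge0 //; lra.
  have : 0 <= d ^+ 2 by rewrite exprn_ge0.
  by rewrite !expr2; nra.
apply: le_trans (_ : W * (L - 2 * l - K) <= _); last first.
  have hm' : d * m * (L - 2 * l - K) <= d * m * (lm - 1) by rewrite ler_wpM2l ?mulr_ge0.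
  have hq' : d ^+ 2 * q * (L - 2 * l - K) <= d ^+ 2 * q * (lq - 1).
    by rewrite ler_wpM2l // mulr_ge0 ?exprn_ge0.
  by rewrite /W mulrDl (mulrA d) (mulrA (d ^+ 2)) lerD.
have e1 : ((n * d - x * d * (d - 1)) / 2 - d * d ^+ 2) * L <= W * L by rewrite ler_wpM2r.
have e2 : d * (d ^+ 2 * L) <= d * (2 * n) by rewrite ler_wpM2l.
have e3 : W * (2 * l + K) <= n * d * (2 * l + K) by rewrite ler_wpM2r //; lra.
have e4 : n * d * (2 + K) <= n * d * (C * l) by rewrite ler_wpM2l // mulr_ge0.
move: e1 e2 e3 e4; clearbody W => e1 e2 e3 e4; lra.
Qed.

(** * Upper and lower bounds for the logarithm of the number of graphs *)

Section Bounds.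
Variable R : realType.
Implicit Types c b : R.

(** The nd/2 edges less the 3T/(d+1) cheap ones guaranteed by T = cnd(d-1)/6 triangles. *)
Definition main_term n d c : R :=
  (n%:R * d%:R - c * n%:R * d%:R * (d%:R - 1) / (d%:R + 1)) / 2.

(** Stated for a subfamily with at least [b] bad vertices to serve twice: [b] = 0 gives the upper
    bound on the whole family, [b] = eps n the bound on the exceptional graphs. *)
Lemma ln_card_upper n d k c b (X : {set graph n}) :
  (2 < k)%N -> (k.-1 <= d)%N -> (0 < n)%N -> (0 < #|X|)%N ->
  (forall E, E \in X -> E \in Gdck n d c k /\ b <= (#|bad_nodes d k E|)%:R) ->
  ln (#|X|)%:R <= (main_term n d c - b / (d%:R + 1) ^+ 2 / 2) * ln n%:R
                  + n%:R * d%:R * (4 * ln d%:R).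
Proof.
move=> k3 kd n0 X0 hX; set phi := _ - _.
have d0 : 0 < d%:R + 1 :> R by rewrite natr1 ltr0n.
have dge2 : (2 <= d)%N by lia.
have few E : E \in X -> exists s : 'S_n, (#|costly E s|)%:R <= phi.
  move=> /hX [+ hb]; rewrite inE => /andP[rE hK].
  have [s hs] := exists_few_costly R rE; exists s.
  have h1 := many_triangles k3 kd rE hK; have h2 := codeg_sum_gain R rE k3.
  move: hs h1 h2; set S := \sum_x _; set T := (\sum_x _)%:R => hs h1 h2.
  have h3 : c * n%:R * d%:R * (d%:R - 1) / (d%:R + 1) <= T / (d%:R + 1).
    by rewrite ler_pM2r ?invr_gt0.
  have h4 : b / (d%:R + 1) ^+ 2 <= (#|bad_nodes d k E|)%:R / (d%:R + 1) ^+ 2.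
    by rewrite ler_pM2r ?invr_gt0 ?exprn_gt0.
  rewrite /phi /main_term; lra.
have phi0 : 0 <= phi.
  by case/card_gt0P: X0 => E /few [s]; apply: le_trans; rewrite ler0n.
have := @card_few_costly n d (Num.truncn phi) X n0.
have hc E : E \in X -> regular d E /\ exists s, (#|costly E s| <= Num.truncn phi)%N.
  move=> EX; split; first by have [] := hX E EX; rewrite inE => /andP[].
  by have [s hs] := few E EX; exists s; rewrite truncn_ge_nat.
move=> /(_ hc); rewrite -(ler_nat R) => le.
have n0R : 0 < n%:R :> R by rewrite ltr0n.
have dd0 : 0 < (4 * d ^ 2)%:R :> R by rewrite ltr0n; nia.
apply: (@le_trans _ _ (ln ((n ^ Num.truncn phi * (4 * d ^ 2) ^ (n * d))%:R : R))).
  by rewrite ler_ln ?posrE ?ltr0n // muln_gt0 !expn_gt0 n0; nia.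
rewrite ln_natXX //; last by rewrite -(ltr0n R).
rewrite (natrM _ n d).
have ln0n : 0 <= ln n%:R :> R by rewrite ln_ge0 // ler1n.
apply: lerD; first by rewrite ler_wpM2r // truncn_le.
rewrite ler_wpM2l // ?mulr_ge0 ?ler0n //.
(* As d >= 2, the base 4 d^2 is at most d^4. *)
have -> : 4 * ln d%:R = ln ((d ^ 4)%:R) :> R.
  by rewrite natrX lnXn ?mulr_natl // ltr0n; lia.
rewrite ler_ln ?posrE // ?ler_nat ?ltr0n ?expn_gt0; last by lia.
rewrite -[4%N]/(2 ^ 2)%N -expnMn (expnM d 2 2) leq_exp2r //; nia.
Qed.

(** Makes room for rounding the number of cliques by up to 2d. With h = 8/(1-c), the product h d^2
    is at most the larger of h^2 and d^4, hence at most n. *)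
Lemma four_sq_le n d c : 0 < c < 1 -> (d ^ 4 <= n)%N -> (8 / (1 - c)) ^+ 2 <= n%:R ->
  4 * d%:R ^+ 2 <= (1 - c) * n%:R / 2.
Proof.
move=> /andP[c0 c1] dn hn; set h := 8 / (1 - c) in hn.
have h0 : 0 < h by rewrite divr_gt0 //; lra.
have key : h * d%:R ^+ 2 <= n%:R.
  have d4 : d%:R ^+ 2 * d%:R ^+ 2 <= n%:R :> R by rewrite -exprD -natrX ler_nat.
  have [le|lt] := leP h (d%:R ^+ 2).
    by apply: le_trans d4; rewrite ler_wpM2r // exprn_ge0.
  by apply: le_trans hn; rewrite [h ^+ 2]expr2 ler_wpM2l // ltW.
have e : (1 - c) * h = 8 by rewrite /h mulrCA mulfV ?mulr1 // gt_eqF //; lra.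
have : (1 - c) * (h * d%:R ^+ 2) <= (1 - c) * n%:R by rewrite ler_wpM2l //; lra.
rewrite mulrA e; lra.
Qed.

(** Both d^2 <= sqrt n and ln n = 2 ln (sqrt n) <= 2 sqrt n. *)
Lemma sq_ln_le n d : (0 < n)%N -> (d ^ 4 <= n)%N -> d%:R ^+ 2 * ln n%:R <= 2 * n%:R :> R.
Proof.
move=> n0 dn; have n0R : 0 < n%:R :> R by rewrite ltr0n.
pose s : R := Num.sqrt n%:R.
have s0 : 0 < s by rewrite sqrtr_gt0.
have ss : s ^+ 2 = n%:R by rewrite sqr_sqrtr // ltW.
have ds : d%:R ^+ 2 <= s.
  have d4 : d%:R ^+ 2 * d%:R ^+ 2 <= n%:R :> R by rewrite -exprD -natrX ler_nat.
  rewrite leNgt; apply/negP => lt; move: d4; rewrite leNgt -ss expr2.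
  by rewrite ltr_pM // ltW.
have ls : ln n%:R <= 2 * s.
  by rewrite -[X in ln X]ss lnXn // -[leLHS]mulr_natl ler_wpM2l // ltW // ln_sublinear.
apply: le_trans (_ : d%:R ^+ 2 * (2 * s) <= _).
  by rewrite ler_wpM2l // exprn_ge0.
by rewrite -ss expr2 mulrCA ler_pM2l // ler_pM2r.
Qed.

Lemma ln_card_lower k c : 0 < c < 1 -> (2 < k)%N ->
  exists C : R, 0 <= C /\ exists N : nat, forall n d : nat,
    (N <= n)%N -> (k.-1 <= d)%N -> (d ^ 4 <= n)%N -> (0 < #|Gdck n d c k|)%N ->
    main_term n d c * ln n%:R - C * (n%:R * d%:R * ln d%:R) <= ln (#|Gdck n d c k|)%:R.
Proof.
move=> c01 k3; case/andP: (c01) => c0 c1.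
(* Collects the constants of m >= cn/(d+1) and q >= (1-c)n/(4d), and the 1 lost in the Stirling
   bound. *)
pose K : R := 1 - ln c - ln ((1 - c) / 4).
have lnc : ln c <= 0 by rewrite ln_le0 // ltW.
have lnc' : ln ((1 - c) / 4) <= 0 by rewrite ln_le0 //; lra.
have K0 : 0 <= K by rewrite /K; lra.
have ln2 : 0 < ln 2 :> R by rewrite ln_gt0 // ltr1n.
(* Since ln 2 <= ln d, the constant 2 + K can be charged to ln d. *)
exists (2 + (2 + K) / ln 2); split.
  by rewrite addr_ge0 // divr_ge0 ?ltW //; lra.
exists (Num.truncn ((8 / (1 - c)) ^+ 2)).+1 => n d Nn kd dn G0.
have n0 : (0 < n)%N by exact: leq_trans Nn.
have k0 : (0 < k)%N by exact: leq_trans k3.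
have dge2 : (2 <= d)%N by apply: leq_trans kd; rewrite -ltnS prednK.
have hn : (8 / (1 - c)) ^+ 2 <= n%:R :> R.
  by apply: ltW; apply: lt_le_trans (truncnS_gt _) _; rewrite ler_nat.
have n0R : 0 < n%:R :> R by rewrite ltr0n.
have d2R : 2 <= d%:R :> R by rewrite ler_nat.
have d0R : 0 < d%:R :> R by rewrite ltr0n (leq_trans _ dge2).
have c4 : 0 < (1 - c) / 4 by rewrite divr_gt0 // subr_gt0.
have h4 := four_sq_le c01 dn hn.
have D0 : 0 < d%:R + 1 :> R by lra.
pose x : R := c * n%:R / (d%:R + 1).
have x0 : 0 < x by rewrite divr_gt0 ?mulr_gt0.
have xe : (d%:R + 1) * x = c * n%:R by rewrite /x mulrCA mulfV ?mulr1 // gt_eqF.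
pose m0 := (Num.truncn x).+1.
have m0x : x < m0%:R by exact: truncnS_gt.
have xm0 : m0%:R <= x + 1 by rewrite /m0 -natr1 lerD2r truncn_le ltW.
have even_nd : ~~ odd (n * d).
  by case/card_gt0P: G0 => E; rewrite inE => /andP[/regular_even].
have fit : (d.+1 * (m0 + 2 * d) <= n)%N.
  rewrite -(ler_nat R) natrM natrD natrM -natr1.
  have : (d%:R + 1) * (m0%:R + 2 * d%:R) <= (d%:R + 1) * (x + 1 + 2 * d%:R) by rewrite ler_pM2l //; lra.
  nra.
have [m [q [m0m mlt en]]] := split_size (ltnW dge2) even_nd fit.
have mx : x <= m%:R by apply: le_trans (ltW m0x) _; rewrite ler_nat.
have mu : m%:R <= x + 2 * d%:R.
  have : m.+1%:R <= m0%:R + 2 * d%:R :> R by rewrite -natrM -natrD ler_nat.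
  rewrite -natr1; lra.
have enR : n%:R = (d%:R + 1) * m%:R + 2 * d%:R * q%:R :> R.
  by rewrite {1}en natrD !natrM natr1.
(* Here 2dq = n - (d+1)m >= (1-c)n - 2d(d+1), and 2d(d+1) <= 4d^2 <= (1-c)n/2. *)
have qx : (1 - c) / 4 * n%:R / d%:R <= q%:R.
  rewrite ler_pdivrMr //.
  have : (d%:R + 1) * m%:R <= (d%:R + 1) * (x + 2 * d%:R) by rewrite ler_pM2l.
  nra.
have [X cX hX] := many_regular_graphs k0 en.
(* The m cliques suffice: k m C(d+1,k) = (d+1) m C(d,k-1) >= c n C(d,k-1). *)
have sub : X \subset Gdck n d c k.
  apply/subsetP => E /hX [rE hE]; rewrite inE rE /=.
  apply: le_trans (_ : (m * 'C(d.+1, k))%:R <= _); last by rewrite ler_nat.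
  have := mul_bin_diag d.+1 k.-1; rewrite prednK //= => /(congr1 (fun i : nat => i%:R : R)).
  rewrite !natrM -natr1 => eb.
  have kR : 0 < k%:R :> R by rewrite ltr0n.
  have B0 : 0 <= ('C(d, k.-1))%:R :> R by rewrite ler0n.
  rewrite -(ler_pM2r kR).
  have -> : c * ('C(d, k.-1))%:R * (n%:R / k%:R) * k%:R = c * n%:R * ('C(d, k.-1))%:R.
    by field; rewrite gt_eqF.
  have -> : m%:R * ('C(d.+1, k))%:R * k%:R = (d%:R + 1) * m%:R * ('C(d, k.-1))%:R :> R.
    by rewrite -mulrA [_ * k%:R]mulrC -eb; ring.
  by rewrite ler_wpM2r // -xe ler_pM2l.
have m1 : (0 < m)%N by exact: leq_trans m0m.
have q1R : 0 < (1 - c) / 4 * n%:R / d%:R by rewrite divr_gt0 // mulr_gt0.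
have q1 : (0 < q)%N by rewrite -(ltr0n R); apply: lt_le_trans qx.
have ld0 : ln 2 <= ln d%:R :> R by rewrite ler_ln ?posrE ?ltr0n // (leq_trans _ dge2).
have lnG : d%:R * (m%:R * (ln m%:R - 1)) + d%:R ^+ 2 * (q%:R * (ln q%:R - 1))
    <= ln (#|Gdck n d c k|)%:R :> R.
  apply: (@le_trans _ _ (ln ((#|X|)%:R : R))).
    rewrite cX ln_natXX ?fact_gt0 // (natrM _ d d) -expr2.
    by apply: lerD; rewrite ler_wpM2l ?exprn_ge0 ?ler0n // ln_fact_ge.
  rewrite ler_ln ?posrE ?ltr0n // ?ler_nat ?subset_leq_card //.
  by rewrite cX muln_gt0 !expn_gt0 !fact_gt0.
have lnm : ln n%:R - 2 * ln d%:R - K <= ln m%:R - 1.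
  have h : ln x <= ln m%:R by rewrite ler_ln ?posrE // ltr0n.
  have ex : ln x = ln c + ln n%:R - ln (d%:R + 1) by exact: ln_mul_div.
  have : ln (d%:R + 1) <= 2 * ln d%:R :> R.
    by rewrite mulr_natl -lnXn // ler_ln ?posrE ?exprn_gt0 //; nra.
  rewrite /K; lra.
have lnq : ln n%:R - 2 * ln d%:R - K <= ln q%:R - 1.
  have h : ln ((1 - c) / 4 * n%:R / d%:R) <= ln q%:R by rewrite ler_ln ?posrE // ltr0n.
  rewrite ln_mul_div // in h; rewrite /K; lra.
have sql := sq_ln_le n0 dn.
have lnn : 0 <= ln n%:R :> R by rewrite ln_ge0 // ler1n.
apply: le_trans lnG.
have xM : main_term n d c = (n%:R * d%:R - x * d%:R * (d%:R - 1)) / 2.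
  by rewrite /main_term /x; congr (_ / 2); field; rewrite gt_eqF.
have CK : 2 + K <= (2 + K) / ln 2 * ln d%:R.
  by rewrite mulrAC ler_pdivlMr // ler_wpM2l // addr_ge0.
have l0 : 0 <= ln d%:R :> R by exact: le_trans (ltW ln2) ld0.
by rewrite xM; apply: lower_bound_arith lnm lnq.
Qed.

End Bounds.

(** * The two claims of the theorem *)

Lemma main_termE (R : realType) n d (c : R) :
  main_term n d c * ln n%:R
    = (1 - c * ((d%:R - 1) / (d%:R + 1))) * (d%:R / 2 * n%:R * ln n%:R).
Proof.
rewrite /main_term; field.
by rewrite natr1 pnatr_eq0.
Qed.

Lemma ln_card_ratio (R : realType) k (c : R) : 0 < c < 1 -> (2 < k)%N ->
  exists C : R, exists N : nat, forall n d : nat,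
    (N <= n)%N -> (k.-1 <= d)%N -> (0 < #|Gdck n d c k|)%N ->
    `| ln (#|Gdck n d c k|)%:R / ((d%:R / 2) * n%:R * ln n%:R)
       - (1 - c * ((d%:R - 1) / (d%:R + 1))) | <= C * (ln d%:R / ln n%:R).
Proof.
move=> c01 k3; case/andP: (c01) => c0 c1.
have [C [C0 [N hN]]] := ln_card_lower c01 k3.
(* Dividing nd ln d by (d/2) n ln n gives 2 ln d / ln n, so the error constants 4 and [C] of the two
   bounds are doubled. *)
exists (8 + 2 * C), (maxn N 2) => n d; rewrite geq_max => /andP[Nn n2] kd G0.
have dge2 : (2 <= d)%N by apply: leq_trans kd; rewrite -ltnS prednK // (leq_trans _ k3).
have n0 : (0 < n)%N by exact: leq_trans n2.
have d2R : 2 <= d%:R :> R by rewrite ler_nat.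
have L0 : 0 < ln n%:R :> R by rewrite ln_gt0 // ltr1n.
have ld0 : 0 < ln d%:R :> R by rewrite ln_gt0 // ltr1n.
have n0R : 0 < n%:R :> R by rewrite ltr0n.
have d0R : 0 < d%:R :> R by lra.
set a := 1 - _; set D := _ * ln n%:R.
have D0 : 0 < D by rewrite /D mulr_gt0 // mulr_gt0 // divr_gt0.
have up : ln (#|Gdck n d c k|)%:R <= a * D + n%:R * d%:R * (4 * ln d%:R).
  rewrite -main_termE.
  have := @ln_card_upper R n d k c 0 (Gdck n d c k) k3 kd n0 G0.
  by rewrite !mul0r subr0; apply.
set G := ln _ in up *.
have G0R : 0 <= G by rewrite /G ln_ge0 // ler1n.
have eD b : b * (n%:R * d%:R * ln d%:R) = b * 2 * (ln d%:R / ln n%:R) * D.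
  by rewrite /D; field; rewrite gt_eqF.
have a1 : a <= 1.
  by rewrite /a lerBlDr lerDl; apply: mulr_ge0; [exact: ltW|apply: divr_ge0; lra].
set r := ln d%:R / ln n%:R in eD *.
have r0 : 0 < r by rewrite divr_gt0.
have Cr0 : 0 <= C * r by rewrite mulr_ge0 // ltW.
rewrite ler_norml; apply/andP; split; last first.
  rewrite lerBlDr ler_pdivrMr //.
  have := eD 4; move: up; have : 0 <= C * r * D by rewrite mulr_ge0 // ltW.
  nra.
rewrite lerBrDr ler_pdivlMr //.
have [dn|dn] := leqP (d ^ 4) n.
  have := hN n d Nn kd dn G0; rewrite main_termE -/a -/D -/G eD.
  have : 0 <= r * D by rewrite mulr_ge0 // ltW.
  nra.
(* For d^4 > n the error term exceeds [a] <= 1, so the required lower bound is at most 0, while ln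
   |G| >= 0. *)
have r4 : 1 <= 4 * r.
  rewrite /r mulrA ler_pdivlMr // mul1r mulr_natl -lnXn //.
  by rewrite ler_ln ?posrE ?exprn_gt0 // -natrX ler_nat ltnW.
apply: le_trans G0R; apply: mulr_le0_ge0; last exact: ltW.
lra.
Qed.

(** Compared with the lower bound for the whole family, the exceptional graphs lose g n ln n with g
    = eps/(2 (d+1)^2). For fixed d this outgrows the error terms of order nd ln d. *)
Lemma few_bad_nodes (R : realType) k (c : R) d (eps delta : R) :
  0 < c < 1 -> (2 < k)%N -> (k.-1 <= d)%N -> 0 < eps -> 0 < delta ->
  exists N : nat, forall n : nat, (N <= n)%N -> (0 < #|Gdck n d c k|)%N ->
    (#|[set E in Gdck n d c k | eps * n%:R < (#|bad_nodes d k E|)%:R]|)%:R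
      <= delta * (#|Gdck n d c k|)%:R.
Proof.
move=> c01 k3 kd eps0 delta0.
have [C [C0 [N hN]]] := ln_card_lower c01 k3.
have dge2 : (2 <= d)%N by apply: leq_trans kd; rewrite -ltnS prednK // (leq_trans _ k3).
have ld0 : 0 < ln d%:R :> R by rewrite ln_gt0 // ltr1n.
have D0 : 0 < (d%:R + 1) ^+ 2 :> R by rewrite natr1 exprn_gt0 // ltr0n.
pose g : R := eps / (d%:R + 1) ^+ 2 / 2.
have g0 : 0 < g by rewrite /g divr_gt0 // divr_gt0.
(* Threshold for ln n beyond which g ln n pays for both errors, 4 from above and [C] from below, and
   for the factor [delta]. *)
pose Y : R := ((4 + C) * (d%:R * ln d%:R) + `|ln delta|) / g.
exists (maxn N (maxn (d ^ 4) (Num.truncn (sequences.expR Y)).+1)) => n.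
rewrite !geq_max => /and3P [Nn dn Yn] G0.
set X := [set E in _ | _].
(* The empty case is set apart because the comparison is made between logarithms. *)
have [X0|X0] := posnP #|X|; first by rewrite X0 mulr_ge0 // ltW.
have n0 : (0 < n)%N by exact: leq_trans Yn.
have n0R : 1 <= n%:R :> R by rewrite ler1n.
have YL : Y <= ln n%:R.
  rewrite -[Y]expRK ler_ln ?posrE ?expR_gt0 ?ltr0n //.
  by apply: ltW; apply: lt_le_trans (truncnS_gt _) _; rewrite ler_nat.
have hX E : E \in X -> E \in Gdck n d c k /\ eps * n%:R <= (#|bad_nodes d k E|)%:R.
  by rewrite inE => /andP[-> /ltW].
have up := ln_card_upper k3 kd n0 X0 hX.
have lo := hN n d Nn kd dn G0.
rewrite -ler_ln ?posrE ?mulr_gt0 ?ltr0n // lnM ?posrE ?ltr0n //.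
have gL : (4 + C) * (d%:R * ln d%:R) + `|ln delta| <= g * ln n%:R.
  by move: YL; rewrite /Y ler_pdivrMr // [_ * g]mulrC.
have gnL : n%:R * ((4 + C) * (d%:R * ln d%:R) + `|ln delta|) <= n%:R * (g * ln n%:R).
  by rewrite ler_wpM2l.
have eg : eps * n%:R / (d%:R + 1) ^+ 2 / 2 = n%:R * g by rewrite /g; ring.
have hd : - ln delta <= n%:R * `|ln delta|.
  apply: le_trans (_ : `|ln delta| <= _); first by rewrite -normrN ler_norm.
  by rewrite ler_peMl.
move: up lo; rewrite eg; move: gnL hd.
move: (ln #|X|%:R) (ln #|Gdck _ _ _ _|%:R) (main_term _ _ _) => lX lG M.
move: (ln n%:R) (ln d%:R) (ln delta) `|ln delta| => L l ldel adel.
rewrite !mulrDr !mulrBl; lra.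
Qed.

Theorem theorem4 (R : realType) (k : nat) (c : R) (d : nat -> nat) :
  (3 <= k)%N -> 0 < c < 1 ->
  (forall n, (k.-1 <= d n)%N) ->
  (* d(n) = o(n) *)
  (forall eps : R, 0 < eps -> exists N : nat, forall n : nat, (N <= n)%N ->
      (d n)%:R <= eps * n%:R) ->
  (exists C : R, exists N : nat, forall n : nat, (N <= n)%N ->
     (0 < #|Gdck n (d n) c k|)%N ->
     `| ln (#|Gdck n (d n) c k|)%:R / (((d n)%:R / 2) * n%:R * ln n%:R)
        - (1 - c * (((d n)%:R - 1) / ((d n)%:R + 1))) |
       <= C * (ln (d n)%:R / ln n%:R))
  /\
  ((exists d0 : nat, forall n, d n = d0) ->
   forall eps : R, 0 < eps ->
   forall delta : R, 0 < delta ->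
   exists N : nat, forall n : nat, (N <= n)%N ->
     (0 < #|Gdck n (d n) c k|)%N ->
     (#|[set E in Gdck n (d n) c k | eps * n%:R < (#|bad_nodes (d n) k E|)%:R]|)%:R
       <= delta * (#|Gdck n (d n) c k|)%:R).
Proof.
move=> k3 c01 kd _; split.
  have [C [N hN]] := ln_card_ratio c01 k3.
  by exists C, N => n Nn; apply: hN.
case=> d0 dE eps eps0 delta delta0.
have kd0 : (k.-1 <= d0)%N by rewrite -(dE 0%N).
have [N hN] := few_bad_nodes c01 k3 kd0 eps0 delta0.
by exists N => n; rewrite dE; apply: hN.
Qed.
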